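(* There is no Borel $\mathbb{C}$-equivariant map $\xi:\mathcal{D}^+_1\to\mathcal{E}_1$ such that $\mathrm{div}(\xi(d))=d$ for all $d\in\mathcal{D}^+_1$.
   Context: A positive divisor is a map $d:\mathbb{C}\to\{0,1,2,\dots\}$ whose support is a closed discrete subset of $\mathbb{C}$; the space $\mathcal{D}^+$ of positive divisors, identified with the measures $\sum_zd(z)\delta_z$, carries the vague topology (the weakest topology making $d\mapsto\sum_zf(z)d(z)$ continuous for every compactly supported continuous $f$). The space $\mathcal{E}$ of entire functions on $\mathbb{C}$ carries the topology of uniform convergence on compact sets. Both carry the corresponding Borel $\sigma$-algebras. The additive group $\mathbb{C}$ acts by $(w\cdot f)(z)=f(z+w)$ and $(w\cdot d)(z)=d(z+w)$. $\mathcal{D}^+_1$ is the set of $d\in\mathcal{D}^+$ whose stabilizer is of the form $\lambda\mathbb{Z}$ for some non-zero $\lambda\in\mathbb{C}$; $\mathcal{E}_1$ is the set of entire functions whose stabilizer is of the form $\lambda\mathbb{Z}$ for some non-zero $\lambda\in\mathbb{C}$. For an entire function $f$ not identically zero, $\mathrm{div}(f)(z)$ is the order of vanishing of $f$ at $z$. *)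

(* Defs.v *)
From HB Require Import structures.
From mathcomp Require Import all_boot all_order all_algebra.
From mathcomp Require Import complex.
From mathcomp Require Import all_classical all_reals all_analysis.
Set Implicit Arguments.
Unset Strict Implicit.
Unset Printing Implicit Defensive.
Import Order.TTheory GRing.Theory Num.Theory.
Import numFieldNormedType.Exports.
Local Open Scope classical_set_scope.
Local Open Scope ring_scope.

(* Typing R[i] as a numClosedFieldType is what gives access to its topology
   and to its structure of normed module over itself. *)
Definition Cplx (R : realType) : numClosedFieldType := R[i].

Definition shift_fun (R : realType) (T : Type) (w : Cplx R) (f : Cplx R -> T) :
  Cplx R -> T := fun z => f (z + w).

Definition discrete_subset (T : topologicalType) (S : set T) : Prop :=
  forall z, S z -> exists2 U, open_nbhs z U & U `&` S = [set z].

Definition div_support (R : realType) (d : Cplx R -> nat) : set (Cplx R) :=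
  [set z | d z != 0%N].

Record posdiv (R : realType) : Type := PosDiv {
  posdiv_fun :> Cplx R -> nat;
  posdiv_closed : closed (div_support posdiv_fun);
  posdiv_discrete : discrete_subset (div_support posdiv_fun) }.

HB.instance Definition _ (R : realType) := gen_eqMixin (posdiv R).
HB.instance Definition _ (R : realType) := gen_choiceMixin (posdiv R).

Record test_fun (R : realType) : Type := TestFun {
  test_fun_fun :> Cplx R -> R;
  test_fun_cont : continuous test_fun_fun;
  test_fun_supp : compact (closure [set z | test_fun_fun z != 0]) }.

(* [\sum_(z \in A)] is the sum over the z where the summand is nonzero when
   there are finitely many of them, as is the case here because the support of
   d is closed and discrete and that of phi is compact. *)
Definition pairing (R : realType) (phi : test_fun R) (d : posdiv R) : R :=
  \sum_(z \in [set: Cplx R]) (phi z *+ d z).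

HB.instance Definition _ (R : realType) :=
  Topological.copy (posdiv R)
    (sup_topology (fun phi : test_fun R =>
       Topological.class (initial_topology (pairing phi)))).

Record entire (R : realType) : Type := Entire {
  entire_fun :> Cplx R -> Cplx R;
  entire_derivable : forall z, derivable entire_fun z 1 }.

HB.instance Definition _ (R : realType) := gen_eqMixin (entire R).
HB.instance Definition _ (R : realType) := gen_choiceMixin (entire R).

HB.instance Definition _ (R : realType) :=
  Topological.copy (entire R)
    (initial_topology
       (fun f : entire R => (f : {family compact, Cplx R -> Cplx R}))).

Lemma posdiv_eqP (R : realType) (d e : posdiv R) : d = e :> (_ -> _) -> d = e.
Proof.
case: d e => [d ? ?] [e ? ?] /= de; subst e.
by congr PosDiv; exact: Prop_irrelevance.
Qed.

Lemma entire_eqP (R : realType) (f g : entire R) : f = g :> (_ -> _) -> f = g.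
Proof.
case: f g => [f ?] [g ?] /= fg; subst g.
by congr Entire; exact: Prop_irrelevance.
Qed.

Lemma continuous_shift (R : realType) (w : Cplx R) :
  continuous (fun z : Cplx R => z + w).
Proof. by move=> z; apply: (@cvgD _ _ _ (nbhs z)); [exact: cvg_id | exact: cvg_cst]. Qed.

Lemma shift_closed (R : realType) (w : Cplx R) (d : posdiv R) :
  closed (div_support (shift_fun w d)).
Proof.
exact: (preimage_closed (in1W (@continuous_shift R w)) (@posdiv_closed R d)).
Qed.

Lemma shift_discrete (R : realType) (w : Cplx R) (d : posdiv R) :
  discrete_subset (div_support (shift_fun w d)).
Proof.
move=> z /(@posdiv_discrete R d)[U [oU Uz] UE].
exists ((fun z => z + w) @^-1` U).
  by split=> //; apply: open_comp oU => y _; exact: continuous_shift.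
apply/seteqP; split=> [y [Uy dy]|y ->].
  have : (U `&` div_support d) (y + w) by [].
  by rewrite UE => /addIr.
by have : (U `&` div_support d) (z + w) by rewrite UE.
Qed.

Definition posdiv_act (R : realType) (w : Cplx R) (d : posdiv R) : posdiv R :=
  PosDiv (@shift_closed R w d) (@shift_discrete R w d).

Lemma shift_derivable (R : realType) (w : Cplx R) (f : entire R) z :
  derivable (shift_fun w f) z 1.
Proof.
have := @entire_derivable R f (z + w).
rewrite /derivable; set F := (X in cvg (X @ _)); set G := (X in _ -> cvg (X @ _)).
suff -> : F = G by [].
by apply/funext => h; rewrite /F /G /shift_fun /= addrA.
Qed.

Definition entire_act (R : realType) (w : Cplx R) (f : entire R) : entire R :=
  Entire (@shift_derivable R w f).

Definition stabilizer (R : realType) (X : Type) (act : Cplx R -> X -> X)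
  (x : X) : set (Cplx R) := [set w | act w x = x].

Definition rank_one (R : realType) (S : set (Cplx R)) : Prop :=
  exists2 lambda : Cplx R, lambda != 0 &
    S = [set lambda *~ n | n in [set: int]].

(* As types, these carry the subspace topology. *)
Definition posdiv1 (R : realType) : set (posdiv R) :=
  [set d | rank_one (stabilizer (@posdiv_act R) d)].

Definition entire1 (R : realType) : set (entire R) :=
  [set f | rank_one (stabilizer (@entire_act R) f)].

Arguments posdiv1 R : clear implicits.
Arguments entire1 R : clear implicits.

Lemma stabilizer_act (R : realType) (X : Type) (act : Cplx R -> X -> X)
    (actD : forall v w x, act v (act w x) = act (v + w) x)
    (act0 : forall x, act 0 x = x) (w : Cplx R) (x : X) :
  stabilizer act (act w x) = stabilizer act x.
Proof.
apply/seteqP; split=> v; rewrite /stabilizer /= actD.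
  by move=> /(congr1 (act (- w))); rewrite !actD addrCA addNr addr0 act0.
by move=> vx; rewrite addrC -actD vx.
Qed.

Lemma posdiv_actD (R : realType) (v w : Cplx R) (d : posdiv R) :
  posdiv_act v (posdiv_act w d) = posdiv_act (v + w) d.
Proof. by apply: posdiv_eqP; apply/funext => z; rewrite /= /shift_fun addrA. Qed.

Lemma posdiv_act0 (R : realType) (d : posdiv R) : posdiv_act 0 d = d.
Proof. by apply: posdiv_eqP; apply/funext => z; rewrite /= /shift_fun addr0. Qed.

Lemma entire_actD (R : realType) (v w : Cplx R) (f : entire R) :
  entire_act v (entire_act w f) = entire_act (v + w) f.
Proof. by apply: entire_eqP; apply/funext => z; rewrite /= /shift_fun addrA. Qed.

Lemma entire_act0 (R : realType) (f : entire R) : entire_act 0 f = f.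
Proof. by apply: entire_eqP; apply/funext => z; rewrite /= /shift_fun addr0. Qed.

Lemma posdiv1_act_subproof (R : realType) (w : Cplx R) (d : posdiv1 R) :
  posdiv_act w (set_val d) \in posdiv1 R.
Proof.
apply/mem_set; rewrite /posdiv1 /=.
rewrite (stabilizer_act (@posdiv_actD R) (@posdiv_act0 R)).
exact: set_mem (svalP d).
Qed.

Definition posdiv1_act (R : realType) (w : Cplx R) (d : posdiv1 R) :
  posdiv1 R := SigSub (posdiv1_act_subproof w d).

Lemma entire1_act_subproof (R : realType) (w : Cplx R) (f : entire1 R) :
  entire_act w (set_val f) \in entire1 R.
Proof.
apply/mem_set; rewrite /entire1 /=.
rewrite (stabilizer_act (@entire_actD R) (@entire_act0 R)).
exact: set_mem (svalP f).
Qed.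

Definition entire1_act (R : realType) (w : Cplx R) (f : entire1 R) :
  entire1 R := SigSub (entire1_act_subproof w f).

Definition borel (T : topologicalType) : set (set T) := <<s @open T >>.

Definition borel_map (T U : topologicalType) (f : T -> U) : Prop :=
  forall B : set U, borel B -> borel (f @^-1` B).

(* f vanishes at z to order exactly n; no n qualifies when f is zero. *)
Definition vanishing_order (R : realType) (f : entire R) (z : Cplx R)
  (n : nat) : Prop :=
  exists2 g : entire R, g z != 0 & forall w, f w = (w - z) ^+ n * g w.

(* The equality div f = d. It is the graph of the partial map div, which is
   undefined at the zero function. *)
Definition is_div (R : realType) (f : entire R) (d : posdiv R) : Prop :=
  forall z, vanishing_order f z (d z).

(* Main.v *)
From HB Require Import structures.
Require Import Defs.
From mathcomp Require Import all_boot all_order all_algebra.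
From mathcomp Require Import finmap complex ring lra zify.
From mathcomp Require Import all_classical all_reals all_analysis.
From mathcomp Require Import measurable_realfun.
Set Implicit Arguments.
Unset Strict Implicit.
Unset Printing Implicit Defensive.
Import Order.TTheory GRing.Theory Num.Theory.
Import numFieldNormedType.Exports.
Local Open Scope classical_set_scope.
Local Open Scope ring_scope.
Local Notation Re := complex.Re.
Local Notation Im := complex.Im.

(** Suppose that [xi] exists. It is enough to look at it along one explicit
    circle of divisors. Fix an irrational [alpha] and let [d_theta] be the sum
    of unit masses at the points [p k + m + i k], with [m] and [k] integers,
    where [p k] is [0] for even [k] and [theta + k alpha] for odd [k]
    ([phase_div]). Irrationality makes the stabilizer exactly the group of
    integers ([phase_div_stabilizer]), the map sending [theta] to [d_theta] is
    vaguely continuous ([phase_div_continuous]), it has period 1, and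
    translating [d_theta] by [2i] gives [d_(theta + 2 alpha)]: on this circle,
    a vertical translation acts as a rotation.

    Put [f_theta = xi(d_theta)]. By equivariance [f_theta] has period 1, so
    along every horizontal line without zeros it has a winding number around
    [0]. Moving the line up by 1 past one row of zeros, which has one simple
    zero per period, lowers the total turn of the argument by [2 pi]
    ([winding_drop]): this is the argument principle. Let [h theta] be the
    total turn of [f_theta] along [Im z = 1/2]. Equivariance turns the
    comparison of the heights [1/2] and [5/2] into
    [h (theta + 2 alpha) = h theta - 4 pi]. But [h] is a Borel function on the
    circle, since [xi] is Borel and [h] is a limit of expressions in finitely
    many values of [f_theta]; and no real-valued measurable function can decrease
    by a constant under a rotation, because the rotation preserves Lebesgue
    measure ([no_drift]): all the sets where [h < n c] would have the same
    measure, which must be 1 as they exhaust the circle, and so would all the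
    sets where [h >= - n c], although the two sets with [n = 0] are disjoint.

    The winding number needs no integration. It is computed on polygons with
    [2 ^ n] vertices per period, adding up the angles between successive
    values; the angle is the arctangent of a quotient of a cross product by a
    dot product, additive and multiplicative as long as all dot products are
    positive. The argument principle for one period of a strip is a discrete
    Green formula: if [f w = (w - z0) * g w] with [g] without zeros in a unit
    square, then [g] turns by [0] around each cell of a fine grid, hence around
    the square, while [w - z0] turns by a quarter of [2 pi] at each corner.
    Only continuity of [f] and [g] is used, and periodicity of [f] cancels the
    two vertical sides. *)

(** * Angles between complex numbers *)

(** The condition on [1 - a * b] says that the two arctangents add up to an
    angle with positive cosine, which keeps the sum in the range of [atan]. *)
Lemma atanD (R : realType) (a b : R) : 0 < 1 - a * b ->
  atan a + atan b = atan ((a + b) / (1 - a * b)).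
Proof.
move=> ab.
set x := atan a; set y := atan b.
have [x1 x2] : - (pi / 2) < x /\ x < pi / 2 by rewrite atan_gtNpi2 atan_ltpi2.
have [y1 y2] : - (pi / 2) < y /\ y < pi / 2 by rewrite atan_gtNpi2 atan_ltpi2.
have cx : 0 < cos x by apply: cos_gt0_pihalf; rewrite x1.
have cy : 0 < cos y by apply: cos_gt0_pihalf; rewrite y1.
have ea : sin x = a * cos x by rewrite -{1}[a]atanK mulfVK// gt_eqF.
have eb : sin y = b * cos y by rewrite -{1}[b]atanK mulfVK// gt_eqF.
have cxy : cos (x + y) = cos x * cos y * (1 - a * b).
  by rewrite cosD ea eb; ring.
have sxy : sin (x + y) = cos x * cos y * (a + b).
  by rewrite sinD ea eb; ring.
have c0 : 0 < cos (x + y) by rewrite cxy !mulr_gt0.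
have p0 := pi_gt0 R.
have xy : x + y \in `](- (pi / 2)), (pi / 2)[.
  rewrite in_itv /=; apply/andP; split; rewrite ltNge; apply/negP => h.
    have : 0 <= sin (- (x + y) - pi / 2) by apply: sin_ge0_pi; lra.
    by rewrite sinB sin_pihalf cos_pihalf mulr0 add0r mulr1 cosN; lra.
  have : 0 <= sin (x + y - pi / 2) by apply: sin_ge0_pi; lra.
  by rewrite sinB sin_pihalf cos_pihalf mulr0 add0r mulr1; lra.
rewrite -(tanK xy) /tan cxy sxy; congr atan.
by field; rewrite !gt_eqF.
Qed.

Lemma atan_inv_half (R : realType) (a b : R) : 0 < a -> 0 < b ->
  atan (a / b) + atan (b / a) = pi / 2.
Proof.
move=> a0 b0; have x1 := atan_ltpi2 (a / b).
have x0 : 0 < atan (a / b) by rewrite -(atan0 R); apply: lt_atan; rewrite divr_gt0.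
have p0 := pi_gt0 R.
have c0 : 0 < cos (atan (a / b)) by apply: cos_gt0_pihalf; apply/andP; split; lra.
have ex : sin (atan (a / b)) = a / b * cos (atan (a / b)).
  by rewrite -[X in _ = X * _]atanK mulfVK// gt_eqF.
suff -> : atan (b / a) = pi / 2 - atan (a / b) by rewrite addrC subrK.
rewrite -(@tanK R (pi / 2 - atan (a / b))); last by rewrite in_itv /=; apply/andP; split; lra.
suff -> : tan (pi / 2 - atan (a / b)) = b / a by [].
rewrite /tan sinB cosB sin_pihalf cos_pihalf ex.
by field; rewrite !gt_eqF.
Qed.

Section Angle.
Variable R : realType.
Implicit Types (z w v : Cplx R) (a b : R).

(** The reals [dot z w] and [cross z w] are the real and imaginary
    parts of [z^* * w], so that [ang z w] is the argument of [w / z] when this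
    quotient lies in the right half-plane. No square root is involved, which
    keeps [ang] a simple measurable expression in the coordinates. *)
Definition dot z w : R := Re z * Re w + Im z * Im w.
Definition cross z w : R := Re z * Im w - Im z * Re w.
Definition ang z w : R := atan (cross z w / dot z w).

Lemma dotzz_gt0 z : z != 0 -> 0 < dot z z.
Proof.
move=> z0; rewrite lt_def addr_ge0 -?expr2 ?sqr_ge0// andbT.
apply: contra_neq z0 => /eqP; rewrite paddr_eq0 ?sqr_ge0// !sqrf_eq0.
by case: z => a b /= /andP[/eqP -> /eqP ->].
Qed.

(** The product of [z^* * w] and [w^* * v] is a positive multiple of [z^* * v]. *)
Lemma angD z w v : 0 < dot z w -> 0 < dot w v -> 0 < dot z v ->
  ang z v = ang z w + ang w v.
Proof.
move=> zw wv zv; rewrite /ang.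
have w0 : 0 < dot w w.
  by apply: dotzz_gt0; apply: contraTneq zw => ->; rewrite /dot /= !mulr0 addr0 ltxx.
have E : 1 - cross z w / dot z w * (cross w v / dot w v) =
         dot w w * dot z v / (dot z w * dot w v).
  rewrite [LHS](_ : _ = (dot z w * dot w v - cross z w * cross w v) / (dot z w * dot w v)).
    by congr (_ / _); rewrite /dot /cross; ring.
  by field; rewrite !gt_eqF.
rewrite atanD E; last by rewrite !(divr_gt0, mulr_gt0).
congr atan.
have -> : cross z v = (cross z w * dot w v + dot z w * cross w v) / dot w w.
  by apply: (canRL (mulfK _)); [rewrite gt_eqF | rewrite /dot /cross; ring].
by field; rewrite !gt_eqF.
Qed.

(** Arguments of quotients add up under multiplication. *)
Lemma angM z z' w w' : 0 < dot z z' -> 0 < dot w w' ->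
  0 < dot (z * w) (z' * w') -> ang (z * w) (z' * w') = ang z z' + ang w w'.
Proof.
have ReM u u' : Re (u * u') = Re u * Re u' - Im u * Im u' by case: u u' => ? ? [].
have ImM u u' : Im (u * u') = Re u * Im u' + Im u * Re u' by case: u u' => ? ? [].
have dE : dot (z * w) (z' * w') = dot z z' * dot w w' - cross z z' * cross w w'.
  by rewrite /dot /cross !ReM !ImM; ring.
have cE : cross (z * w) (z' * w') = cross z z' * dot w w' + dot z z' * cross w w'.
  by rewrite /dot /cross !ReM !ImM; ring.
rewrite /ang cE dE; move: (dot z z') (dot w w') => d d' d0 d0' p.
have E a b : 1 - a / d * (b / d') = (d * d' - a * b) / (d * d').
  by field; rewrite !gt_eqF.
rewrite atanD E; last by rewrite !(divr_gt0, mulr_gt0).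
by congr atan; field; rewrite !gt_eqF.
Qed.

End Angle.

(** * Turn of a polygon around the origin *)

Section Turn.
Variable R : realType.
Implicit Types (c : nat -> Cplx R) (N : nat).

Definition turn c N : R := \sum_(0 <= j < N) ang (c j) (c j.+1).

(** In the half-plane around the direction [r] the argument measured from [r]
    is a single-valued function, and the turn telescopes. *)
Lemma turn_half_plane (r : Cplx R) c N :
  (forall j, (j <= N)%N -> 0 < dot r (c j)) ->
  (forall j, (j < N)%N -> 0 < dot (c j) (c j.+1)) ->
  turn c N = ang r (c N) - ang r (c 0%N).
Proof.
move=> rc cc; rewrite -(@telescope_sumr R 0 N (fun j => ang r (c j)))//.
apply: eq_big_nat => j /andP[_ jN].
by rewrite (angD (rc _ (ltnW jN)) (cc _ jN) (rc _ jN)) addrC addKr.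
Qed.

(** Discrete Green formula: around each cell of the grid both ways from one
    corner to the opposite one give the same angle, and the contributions of
    the inner edges cancel. *)
Lemma turn_box_nonvanishing (c : nat -> nat -> Cplx R) N :
  (forall j k (a b a' b' : bool), (j < N)%N -> (k < N)%N ->
    0 < dot (c (j + a) (k + b))%N (c (j + a') (k + b'))%N) ->
  turn (c ^~ 0%N) N + turn (c N) N = turn (c 0%N) N + turn (c ^~ N) N.
Proof.
move=> cc.
have cell j k : (j < N)%N -> (k < N)%N ->
    ang (c j k) (c j.+1 k) + ang (c j.+1 k) (c j.+1 k.+1) =
    ang (c j k) (c j k.+1) + ang (c j k.+1) (c j.+1 k.+1).
  move=> jN kN; rewrite -!angD//.
  - by have := cc j k false false false true jN kN; rewrite !addn0 !addn1.
  - by have := cc j k false true true true jN kN; rewrite !addn0 !addn1.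
  - by have := cc j k false false true true jN kN; rewrite !addn0 !addn1.
  - by have := cc j k false false true false jN kN; rewrite !addn0 !addn1.
  - by have := cc j k true false true true jN kN; rewrite !addn0 !addn1.
  - by have := cc j k false false true true jN kN; rewrite !addn0 !addn1.
have row k : (k < N)%N -> turn (c ^~ k) N + ang (c N k) (c N k.+1) =
    ang (c 0%N k) (c 0%N k.+1) + turn (c ^~ k.+1) N.
  move=> kN; suff H m : (m <= N)%N ->
      turn (c ^~ k) m + ang (c m k) (c m k.+1) =
      ang (c 0%N k) (c 0%N k.+1) + turn (c ^~ k.+1) m by exact: H.
  elim: m => [_|m IH mN]; first by rewrite /turn !big_geq// addr0 add0r.
  rewrite /turn !big_nat_recr//= -!/(turn _ _) -addrA cell//.
  by rewrite addrA IH 1?ltnW// addrA.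
suff H k : (k <= N)%N -> turn (c ^~ 0%N) N + turn (c N) k =
    turn (c 0%N) k + turn (c ^~ k) N by exact: H.
elim: k => [_|k IH kN]; first
  by rewrite [turn (c N) _]big_geq// [turn (c 0%N) _]big_geq// addr0 add0r.
rewrite [turn (c N) _]big_nat_recr//= [turn (c 0%N) _]big_nat_recr//=.
by rewrite addrA IH 1?ltnW// -addrA row// addrA.
Qed.

(** On each side of the box the argument can be measured from the outer normal
    direction of that side. Changing the reference direction at a corner costs
    [pi / 2], and there are four corners. *)
Lemma turn_box_around_zero (c : nat -> nat -> Cplx R) N :
  (forall j, (j <= N)%N ->
    [/\ Im (c j 0%N) < 0, 0 < Re (c N j), 0 < Im (c j N) & Re (c 0%N j) < 0]) ->
  (forall j, (j < N)%N -> 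
    [/\ 0 < dot (c j 0%N) (c j.+1 0%N), 0 < dot (c N j) (c N j.+1),
     0 < dot (c j N) (c j.+1 N) & 0 < dot (c 0%N j) (c 0%N j.+1)]) ->
  turn (c ^~ 0%N) N + turn (c N) N = turn (c 0%N) N + turn (c ^~ N) N + 2 * pi.
Proof.
move=> cs cc.
have dE a b z : dot (a +i* b)%C z = a * Re z + b * Im z by [].
have xE a b z : cross (a +i* b)%C z = a * Im z - b * Re z by [].
rewrite (@turn_half_plane (0 +i* (-1))%C (c ^~ 0%N)); last 2 first.
- by move=> j /cs[? ? ? ?]; rewrite dE; lra.
- by move=> j /cc[].
rewrite (@turn_half_plane (1 +i* 0)%C (c N)); last 2 first.
- by move=> j /cs[? ? ? ?]; rewrite dE; lra.
- by move=> j /cc[].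
rewrite (@turn_half_plane (0 +i* 1)%C (c ^~ N)); last 2 first.
- by move=> j /cs[? ? ? ?]; rewrite dE; lra.
- by move=> j /cc[].
rewrite (@turn_half_plane ((-1) +i* 0)%C (c 0%N)); last 2 first.
- by move=> j /cs[? ? ? ?]; rewrite dE; lra.
- by move=> j /cc[].
have [? ? ? ?] := cs 0%N (leq0n N); have [? ? ? ?] := cs N (leqnn N).
rewrite /ang !dE !xE !mul0r !mul1r !mulN1r ?oppr0 ?addr0 ?add0r ?subr0 ?sub0r ?opprK.
have q1 : atan (Im (c N N) / Re (c N N)) + atan (Re (c N N) / Im (c N N)) = pi / 2.
  exact: atan_inv_half.
have q2 : atan (- Im (c N 0) / Re (c N 0)) + atan (Re (c N 0) / - Im (c N 0)) = pi / 2.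
  by apply: atan_inv_half; rewrite ?oppr_gt0.
have q3 : atan (Im (c 0 N) / - Re (c 0 N)) + atan (- Re (c 0 N) / Im (c 0 N)) = pi / 2.
  by apply: atan_inv_half; rewrite ?oppr_gt0.
have q4 : atan (- Im (c 0 0) / - Re (c 0 0)) + atan (- Re (c 0 0) / - Im (c 0 0)) = pi / 2.
  by apply: atan_inv_half; rewrite ?oppr_gt0.
move: q1 q2 q3 q4.
rewrite !(mulNr, mulrN, invrN, opprK, atanN).
lra.
Qed.

Lemma turn_mul (c d e : nat -> Cplx R) N :
  (forall j, e j = c j * d j) ->
  (forall j, (j < N)%N -> [/\ 0 < dot (c j) (c j.+1), 0 < dot (d j) (d j.+1) &
     0 < dot (e j) (e j.+1)]) ->
  turn e N = turn c N + turn d N.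
Proof.
move=> E H; rewrite /turn -big_split; apply: eq_big_nat => j /andP[_ /H[? ? h3]].
by rewrite !E in h3 *; apply: angM.
Qed.

(** By [angD] an edge may be subdivided; the positive dot products rule out a
    detour of the new vertex around the origin. *)
Lemma turn_double (c d : nat -> Cplx R) N : (forall j, d j.*2 = c j) ->
  (forall j, (j < N)%N -> [/\ 0 < dot (c j) (c j.+1),
     0 < dot (d j.*2) (d j.*2.+1) & 0 < dot (d j.*2.+1) (d j.*2.+2)]) ->
  turn d N.*2 = turn c N.
Proof.
move=> dc; elim: N => [|N IH] H; first by rewrite /turn !big_geq.
rewrite doubleS /turn !big_nat_recr//= -/(turn _ _) -/(turn c _) IH; last first.
  by move=> j jN; apply: H; exact: ltnW.
have [h1 h2 h3] := H _ (leqnn _).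
rewrite -addrA -angD ?h2 ?h3 -?doubleS ?dc ?h1 //.
Qed.

(** This moves the starting vertex off a vertical line through a zero. *)
Lemma turn_rot (c : nat -> Cplx R) N m : (forall j, c (N + j)%N = c j) ->
  turn (fun j => c (m + j)%N) N = turn c N.
Proof.
move=> cN; elim: m => [|m IH]; first by [].
rewrite -IH; case: N cN {IH} => [|N] cN; first by rewrite /turn !big_geq.
rewrite /turn [RHS]big_nat_recl// [LHS]big_nat_recr//= addrC.
congr (_ + _); last by apply: eq_bigr => j _; rewrite !addSnnS.
by rewrite -(cN (m + 0)%N) -(cN (m + 1)%N); congr (ang (c _) (c _)); lia.
Qed.
End Turn.

(** * Continuity and compactness in the plane *)

Section Plane.
Variable R : realType.

Definition cart (p : R * R) : Cplx R := (p.1 +i* p.2)%C.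

Lemma norm_Re (z : Cplx R) : (`|Re z|%:C)%C <= `|z|.
Proof.
rewrite normc_def lecR -sqrtr_sqr ler_wsqrtr// lerDl sqr_ge0 //.
Qed.

Lemma norm_Im (z : Cplx R) : (`|Im z|%:C)%C <= `|z|.
Proof.
rewrite normc_def lecR -sqrtr_sqr ler_wsqrtr// lerDr sqr_ge0 //.
Qed.

Lemma norm_cart (p : R * R) : `|cart p| <= (`|p.1| + `|p.2|)%:C%C.
Proof.
rewrite normc_def lecR /= -[leRHS]ger0_norm ?addr_ge0// -sqrtr_sqr ler_wsqrtr//.
by rewrite sqrrD !real_normK ?num_real// -addrA lerD2l lerDr mulrn_wge0 ?mulr_ge0.
Qed.

Lemma Re_continuous : continuous (fun z : Cplx R => Re z).
Proof.
move=> z; apply/(@cvgrPdist_lt _ _ _ (nbhs z)) => e e0.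
have e0' : (0 : Cplx R) < (e%:C)%C by rewrite ltcR.
near=> w.
rewrite -ltcR -raddfB; apply: le_lt_trans (norm_Re _) _.
by near: w; exact: cvgr_dist_lt.
Unshelve. all: end_near. Qed.

Lemma Im_continuous : continuous (fun z : Cplx R => Im z).
Proof.
move=> z; apply/(@cvgrPdist_lt _ _ _ (nbhs z)) => e e0.
have e0' : (0 : Cplx R) < (e%:C)%C by rewrite ltcR.
near=> w.
rewrite -ltcR -raddfB; apply: le_lt_trans (norm_Im _) _.
by near: w; exact: cvgr_dist_lt.
Unshelve. all: end_near. Qed.

Lemma cart_continuous : continuous cart.
Proof.
move=> p; apply/(@cvgrPdist_lt _ (Cplx R) _ (nbhs p)) => e e0.
have [r r0 re] : exists2 r : R, 0 < r & (r%:C)%C <= e.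
  case: e e0 => a b; rewrite ltcE /= => /andP[/eqP -> a0].
  by exists a.
near=> q.
have -> : cart p - cart q = cart (p - q) by [].
apply: le_lt_trans (norm_cart _) _.
apply: lt_le_trans re; rewrite ltcR (splitr r) ltrD//.
  near: q; apply: cvgr_dist_lt; rewrite ?divr_gt0//; exact: cvg_fst.
near: q; apply: cvgr_dist_lt; rewrite ?divr_gt0//; exact: cvg_snd.
Unshelve. all: end_near. Qed.

Lemma dot_continuous (T : topologicalType) (F G : T -> Cplx R) :
  continuous F -> continuous G -> continuous (fun p => dot (F p) (G p)).
Proof.
move=> cF cG p; apply: cvgD; apply: cvgM; apply: continuous_comp;
  by [exact: cF|exact: cG|exact: Re_continuous|exact: Im_continuous].
Qed.

(** Uniform continuity in the form used for polygons: on a compact set without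
    zeros, nearby values of [F] lie in a common open half-plane. Each point has
    a neighbourhood with this property, because [dot (F p) (F p)] is positive,
    and compactness makes its size uniform. *)
Lemma near_dot_gt0 (F : R * R -> Cplx R) (K : set (R * R)) :
  continuous F -> compact K -> (forall p, K p -> F p != 0) ->
  \forall n \near \oo, forall p q, K p -> `|p - q| <= 2 ^- n -> 0 < dot (F p) (F q).
Proof.
move=> cF /compact_near_coveringP cK F0.
pose P n p := forall q, `|p - q| <= 2 ^- n -> 0 < dot (F p) (F q).
suff : \forall n \near \oo, K `<=` P n.
  by apply: filterS => n H p q Kp; exact: H.
apply: cK => p Kp.
have : continuous (fun u : (R * R) * (R * R) => dot (F u.1) (F u.2)).
  by apply: dot_continuous => u; apply: continuous_comp => //; [exact: cvg_fst|exact: cF|exact: cvg_snd|exact: cF].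
move=> /(_ (p, p)) /(cvgr_gt _)/(_ 0 (dotzz_gt0 (F0 _ Kp))) /nbhs_ballP [e /= e0 He].
have e20 : 0 < e / 2 by rewrite divr_gt0.
exists (ball p (e / 2), [set n | 2 ^- n < e / 2]) => /=.
  split; first exact: nbhsx_ballx.
  have := near_infty_natSinv_expn_lt (PosNum e20).
  by apply: filterS => n /=; rewrite div1r.
move=> [q n] [/= pq qn] u qu; apply: (He (q, u)); split => /=.
  by apply: le_ball pq; rewrite ler_pdivrMr// mulr_natr mulr2n lerDl ltW.
have -> : e = e / 2 + e / 2 by rewrite -splitr.
apply: ball_triangle pq _; rewrite -ball_normE /ball_ /=.
exact: le_lt_trans qu qn.
Qed.

Lemma compact_box (a b c d : R) : compact (`[a, b]%classic `*` `[c, d]%classic).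
Proof. by apply: compact_setX; exact: segment_compact. Qed.

End Plane.

(** * Argument principle for a simple zero *)

Section Winding.
Variable R : realType.
Implicit Types (f g : Cplx R -> Cplx R) (x y : R) (n : nat).

Definition grid x y n (j k : nat) : R * R :=
  (x + j%:R * 2 ^- n, y + k%:R * 2 ^- n).

(** The polygon has [2 ^ n] edges rather than [n], so that each polygon refines
    the previous ones and [turn_double] compares them. *)
Definition winding_approx f x y n : R :=
  turn (fun j => f (cart (x + j%:R * 2 ^- n, y))) (2 ^ n).

Lemma pow2V_gt0 n : 0 < 2 ^- n :> R.
Proof. by rewrite invr_gt0 exprn_gt0. Qed.

Lemma grid_end n : (2 ^ n)%:R * 2 ^- n = 1 :> R.
Proof. by rewrite natrX mulfV// expf_neq0. Qed.

Lemma grid_bound (j n : nat) : (j <= 2 ^ n)%N -> 0 <= (j%:R * 2 ^- n : R) <= 1.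
Proof.
move=> jn; rewrite mulr_ge0 ?(ltW (pow2V_gt0 n))//= -[leRHS](grid_end n).
by rewrite ler_pM2r ?pow2V_gt0// ler_nat.
Qed.

Lemma grid_dist x y n j k (a b a' b' : bool) :
  `|grid x y n (j + a) (k + b) - grid x y n (j + a') (k + b')| <= 2 ^- n.
Proof.
have := pow2V_gt0 n; rewrite /grid; move: (2 ^- n) => h h0.
rewrite prod_normE /= ge_max.
have H (u : R) (i : nat) (c d : bool) :
    `|u + (i + c)%:R * h - (u + (i + d)%:R * h)| <= h.
  rewrite !natrD.
  have -> : u + (i%:R + c%:R) * h - (u + (i%:R + d%:R) * h) = (c%:R - d%:R) * h by ring.
  by case: c d => [] [] /=; rewrite ?subrr ?subr0 ?sub0r ?mul0r ?mul1r ?mulN1r ?normrN ?normr0 ?gtr0_norm// ltW.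
by rewrite !H.
Qed.

Lemma winding_stable f x y : continuous f ->
  (forall u, x <= u <= x + 1 -> f (cart (u, y)) != 0) ->
  \forall n \near \oo, winding_approx f x y n.+1 = winding_approx f x y n.
Proof.
move=> cf f0.
pose F := f \o @cart R.
have cF : continuous F by move=> p; apply: continuous_comp; [exact: cart_continuous|exact: cf].
have cK := @compact_box R x (x + 1) y y.
have F0 p : (`[x, x + 1]%classic `*` `[y, y]%classic) p -> F p != 0.
  case: p => p1 p2 [/= + /itvP h]; rewrite in_itv /= => /f0.
  by have -> : p2 = y by apply/eqP; rewrite eq_le !h.
have [N _ HN] := near_dot_gt0 cF cK F0.
exists N => // n /= Nn.
rewrite /winding_approx expnS mul2n; apply: turn_double.
  move=> j; congr (f (cart (_, _))); congr (_ + _).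
  by rewrite -mul2n natrM exprS invfM mulrACA mulfV ?mul1r.
have G m j j' : (N <= m)%N -> (j <= 2 ^ m)%N -> (j' = j \/ j' = j.+1) ->
   0 < dot (f (cart (x + j%:R * 2 ^- m, y))) (f (cart (x + j'%:R * 2 ^- m, y))).
  move=> Nm jm jj'; apply: (HN m Nm (_, _) (_, _)).
    have := grid_bound jm; split => /=; rewrite in_itv /= ?lexx//.
    by rewrite lerDl lerD2l.
  have -> : (x + j%:R * 2 ^- m, y) = grid x y m (j + false) (0 + false).
    by rewrite /grid !addn0 mul0r addr0.
  have -> : (x + j'%:R * 2 ^- m, y) = grid x y m (j + (j' != j)) (0 + false).
    rewrite /grid !addn0 mul0r addr0.
    by case: jj' => ->; rewrite ?eqxx ?addn0// -addn1 -[X in _ == X]addn0 eqn_add2l.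
  exact: grid_dist.
move=> j jn; split; apply: G; rewrite ?leqW//; try by [right|exact: ltnW].
  by rewrite expnS mul2n leq_double ltnW.
by rewrite expnS mul2n ltn_double.
Qed.

(** In a strip with a single zero per period the line [Re z = 0] may meet that
    zero; the line [Re z = 1 / 2] then does not, and its abscissa belongs to all
    the grids but the first. *)
Lemma winding_base f y n : (forall z, f (z + 1) = f z) ->
  winding_approx f (1 / 2) y n.+1 = winding_approx f 0 y n.+1.
Proof.
move=> f1; rewrite /winding_approx.
rewrite -(@turn_rot _ (fun j => f (cart (0 + j%:R * 2 ^- n.+1, y))) (2 ^ n.+1) (2 ^ n)).
  congr turn; apply/funext => j; congr (f (cart (_, _))).
  rewrite natrD mulrDl add0r; congr (_ + _).
  by rewrite exprS invfM mulrCA grid_end mulr1 div1r.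
move=> j; rewrite -[RHS]f1; congr f.
rewrite /cart /= natrD mulrDl grid_end !add0r addrC.
by rewrite -[in LHS](addr0 y).
Qed.

(** Argument principle for a simple zero in a unit square. The factor [w - z0]
    turns by [2 * pi] around the boundary, the factor [g] by [0]; the vertical
    sides cancel by periodicity, and what is left is the difference between
    the two horizontal sides. *)
Lemma winding_step f g (z0 : Cplx R) x y :
  continuous f -> continuous g ->
  (forall w, f w = (w - z0) * g w) -> (forall w, f (w + 1) = f w) ->
  x < Re z0 < x + 1 -> y < Im z0 < y + 1 -> g z0 != 0 ->
  (forall w, x <= Re w <= x + 1 -> y <= Im w <= y + 1 -> w != z0 -> f w != 0) ->
  \forall n \near \oo,
    winding_approx f x y n = winding_approx f x (y + 1) n + 2 * pi.
Proof.
move=> cf cg fE f1 /andP[xz zx] /andP[yz zy] g0 f0.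
pose F := f \o @cart R; pose G := g \o @cart R; pose L := fun p => @cart R p - z0.
have cc := @cart_continuous R.
have cF : continuous F by move=> p; apply: continuous_comp; [exact: cc|exact: cf].
have cG : continuous G by move=> p; apply: continuous_comp; [exact: cc|exact: cg].
have cL : continuous L by move=> p; apply: cvgB; [exact: cc|exact: cvg_cst].
(* [g] is considered on the whole square [K], [f] and [w - z0] only on its
   boundary [B], where they do not vanish. *)
pose K := (`[x, x + 1]%classic `*` `[y, y + 1]%classic).
pose B := (`[x, x + 1]%classic `*` `[y, y]%classic) `|`
  (`[x + 1, x + 1]%classic `*` `[y, y + 1]%classic) `|`
  (`[x, x + 1]%classic `*` `[y + 1, y + 1]%classic) `|`
  (`[x, x]%classic `*` `[y, y + 1]%classic).
have cB : compact B by do !apply: compactU; exact: compact_box.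
have G0 p : K p -> G p != 0.
  case: p => p1 p2 [/=]; rewrite !in_itv /= => h1 h2; rewrite /G /=.
  have [->//|nz] := eqVneq (cart (p1, p2)) z0.
  by have := f0 (cart (p1, p2)) h1 h2 nz; rewrite fE mulf_eq0 negb_or => /andP[].
have L0 p : B p -> L p != 0.
  rewrite subr_eq0 => Bp; apply/eqP => pz.
  move: xz zx yz zy; rewrite -pz /=.
  by case: p {pz} Bp => p1 p2 [[[|]|]|] [] /=; rewrite !in_itv /=; lra.
have BK p : B p -> K p.
  case: p => p1 p2; rewrite /K /=.
  by case=> [[[|]|]|] [] /=; rewrite !in_itv /= => h1 h2; split; lra.
have F0 p : B p -> F p != 0.
  by move=> Bp; rewrite /F /= fE mulf_neq0//; [exact: L0|apply/G0/BK].
near=> n.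
have hF p q : B p -> `|p - q| <= 2 ^- n -> 0 < dot (F p) (F q).
  by move: p q; near: n; exact: near_dot_gt0.
have hL p q : B p -> `|p - q| <= 2 ^- n -> 0 < dot (L p) (L q).
  by move: p q; near: n; exact: near_dot_gt0.
have hG p q : K p -> `|p - q| <= 2 ^- n -> 0 < dot (G p) (G q).
  by move: p q; near: n; apply: near_dot_gt0 => //; exact: compact_box.
pose P := grid x y n.
have P0 j : (x + j%:R * 2 ^- n, y) = P j 0%N by rewrite /P /grid mul0r addr0.
have P1 j : (x + j%:R * 2 ^- n, y + 1) = P j (2 ^ n)%N by rewrite /P /grid grid_end.
have tG := @turn_box_nonvanishing R (fun j k => G (P j k)) (2 ^ n).
have tL := @turn_box_around_zero R (fun j k => L (P j k)) (2 ^ n).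
have dP j k (a b a' b' : bool) : 
   `|P (j + a)%N (k + b)%N - P (j + a')%N (k + b')%N| <= 2 ^- n by exact: grid_dist.
have d1 j k : `|P j k - P j.+1 k| <= 2 ^- n.
  by have := dP j k false false true false; rewrite !addn0 addn1.
have d2 j k : `|P j k - P j k.+1| <= 2 ^- n.
  by have := dP j k false false false true; rewrite !addn0 addn1.
have KP j k : (j <= 2 ^ n)%N -> (k <= 2 ^ n)%N -> K (P j k).
  by move=> /grid_bound h /grid_bound h'; split; rewrite /= in_itv /=; lra.
have BP j : (j <= 2 ^ n)%N -> 
    [/\ B (P j 0%N), B (P (2 ^ n)%N j), B (P j (2 ^ n)%N) & B (P 0%N j)].
  move=> /grid_bound h; rewrite /P /grid grid_end mul0r !addr0.
  split; [do 3 left|do 2 left; right|left; right|right]; split; rewrite /= in_itv /= ?lexx//; lra.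
have {}tG : turn (fun j => G (P j 0%N)) (2 ^ n) + turn (fun k => G (P (2 ^ n)%N k)) (2 ^ n) =
   turn (fun k => G (P 0%N k)) (2 ^ n) + turn (fun j => G (P j (2 ^ n)%N)) (2 ^ n).
  apply: tG => j k a b a' b' jn kn; apply: hG; last exact: dP.
  by apply: KP; [case: a|case: b]; rewrite ?addn1 ?addn0// ltnW.
have {}tL : turn (fun j => L (P j 0%N)) (2 ^ n) + turn (fun k => L (P (2 ^ n)%N k)) (2 ^ n) =
   turn (fun k => L (P 0%N k)) (2 ^ n) + turn (fun j => L (P j (2 ^ n)%N)) (2 ^ n) + 2 * pi.
  apply: tL => j jn.
    have ReL p : Re (L p) = p.1 - Re z0 by rewrite /L raddfB.
    have ImL p : Im (L p) = p.2 - Im z0 by rewrite /L raddfB.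
    by rewrite !ReL !ImL /P /grid /= grid_end mul0r !addr0; split; lra.
  by have [? ? ? ?] := BP j (ltnW jn); split; apply: hL.
have FLG (c : nat -> R * R) : (forall j, (j < 2 ^ n)%N -> B (c j) /\ `|c j - c j.+1| <= 2 ^- n) ->
   turn (fun j => F (c j)) (2 ^ n) = turn (fun j => L (c j)) (2 ^ n) + turn (fun j => G (c j)) (2 ^ n).
  move=> Bc; apply: turn_mul => j; first exact: fE.
  by move=> /Bc[? ?]; split; [exact: hL|apply: hG => //; exact: BK|exact: hF].
have e1 := FLG (P ^~ 0%N) (fun j jn => conj (let: And4 h _ _ _ := BP j (ltnW jn) in h) (d1 _ _)).
have e2 := FLG (P (2 ^ n)%N) (fun j jn => conj (let: And4 _ h _ _ := BP j (ltnW jn) in h) (d2 _ _)).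
have e3 := FLG (P ^~ (2 ^ n)%N) (fun j jn => conj (let: And4 _ _ h _ := BP j (ltnW jn) in h) (d1 _ _)).
have e4 := FLG (P 0%N) (fun j jn => conj (let: And4 _ _ _ h := BP j (ltnW jn) in h) (d2 _ _)).
have {}e2 : turn (fun j => F (P 0%N j)) (2 ^ n) =
    turn (fun j => L (P (2 ^ n)%N j)) (2 ^ n) + turn (fun j => G (P (2 ^ n)%N j)) (2 ^ n).
  rewrite -e2; congr turn.
  apply/funext => j; rewrite /F /= -[LHS]f1; congr f.
  by rewrite /P /grid grid_end mul0r addr0 -[X in cart (x + 1, X)]addr0.
have -> : winding_approx f x y n = turn (fun j => F (P j 0%N)) (2 ^ n).
  by rewrite /winding_approx; congr turn; apply/funext => j; rewrite P0.
have -> : winding_approx f x (y + 1) n = turn (fun j => F (P j (2 ^ n)%N)) (2 ^ n).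
  by rewrite /winding_approx; congr turn; apply/funext => j; rewrite P1.
lra.
Unshelve. all: end_near. Qed.

End Winding.

(** * Rotations of the circle *)

Section Drift.
Variable R : realType.
Notation mu := (@lebesgue_measure R).

Lemma measurable_shift (b : R) :
  measurable_fun setT (fun x : measurableTypeR R => (x + b : measurableTypeR R)).
Proof.
apply: continuous_measurable_fun => x.
by apply: cvgD; [exact: cvg_id|exact: cvg_cst].
Qed.

Lemma lebesgue_measure_shift (b : R) (A : set (measurableTypeR R)) :
  measurable A -> mu ((fun x : R => x + b) @^-1` A) = mu A.
Proof.
move=> mA.
pose f : {mfun (measurableTypeR R) >-> (measurableTypeR R)} :=
  HB.pack (fun x : measurableTypeR R => (x + b : measurableTypeR R)) (isMeasurableFun.Build _ _ _ _ _ (measurable_shift b)).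
apply/esym; rewrite -[RHS]/(pushforward mu f A).
apply: lebesgue_measure_unique => //= _ [[s t]] _ <-.
rewrite /pushforward.
have -> : f @^-1` `]s, t]%classic = `](s - b), (t - b)]%classic.
  by apply/seteqP; split => x /=; rewrite !in_itv /= ltrBlDr lerBrDr.
by rewrite !lebesgue_measure_itv/= !lte_fin ltrD2r -!EFinB; congr (if _ then _%:E else _); ring.
Qed.

(** The half-open unit interval is a fundamental domain for the translation by
    1; rotating by [b] moves a piece of length [b] out of it, which the
    translation by [-1] brings back. *)
Lemma lebesgue_measure_circle_rotation (b : R) (E : set (measurableTypeR R)) :
  measurable E -> (forall x, E (x + 1) <-> E x) -> 0 <= b <= 1 ->
  mu ((fun x : R => x + b) @^-1` E `&` `[0, 1[) = mu (E `&` `[0, 1[).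
Proof.
move=> mE E1 /andP[b0 b1].
have -> : (fun x : R => x + b) @^-1` E `&` `[0, 1[ =
          (fun x : R => x + b) @^-1` (E `&` `[b, 1 + b[).
  by apply/seteqP; split => x /=; rewrite !in_itv /= ltrD2r lerDr.
rewrite lebesgue_measure_shift; last exact: measurableI.
have -> : E `&` `[b, 1 + b[ = (E `&` `[b, 1[) `|` (E `&` `[1, 1 + b[).
  rewrite -setIUr; congr (_ `&` _); apply/seteqP; split => x /=; rewrite !in_itv /=.
    by case: (ltP x 1) => h; [left|right]; lra.
  by case; lra.
have -> : E `&` `[0, 1[ = (E `&` `[b, 1[) `|` (E `&` `[0, b[).
  rewrite -setIUr; congr (_ `&` _); apply/seteqP; split => x /=; rewrite !in_itv /=.
    by case: (ltP x b) => h; [right|left]; lra.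
  by case; lra.
rewrite !measureU; try exact: measurableI; last 2 first.
- by apply/seteqP; split => x //= [[_ +] [_]]; rewrite !in_itv /=; lra.
- by apply/seteqP; split => x //= [[_ +] [_]]; rewrite !in_itv /=; lra.
congr (_ + _)%E; rewrite -[LHS](@lebesgue_measure_shift 1); last exact: measurableI.
congr (mu _); apply/seteqP; split => x /= [/E1 Ex]; rewrite !in_itv /= => ?; split => //; lra.
Qed.

(** The rotation pulls [h < n * c] back to [h < n.+1 * c], so that all these
    sets have the same measure; their union being the circle, it is
    1. The same holds for the sets where [h] is at least [- (n * c)]. The two
    sets obtained for [n = 0] are complementary: a contradiction. *)
Lemma no_drift (h : R -> R) (b c : R) :
  measurable_fun [set: measurableTypeR R] h ->
  (forall x, h (x + 1) = h x) -> 0 <= b <= 1 -> 0 < c ->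
  (forall x, h (x + b) = h x - c) -> False.
Proof.
move=> mh h1 b01 c0 hb.
pose A (n : nat) : set (measurableTypeR R) := [set x | h x < n%:R * c].
pose B (n : nat) : set (measurableTypeR R) := [set x | - (n%:R * c) <= h x].
have mA n : measurable (A n).
  have := mh measurableT _ (measurable_itv `]-oo, (n%:R * c)[).
  by rewrite setTI (_ : _ @^-1` _ = A n)//; apply/seteqP; split => x /=; rewrite in_itv.
have mB n : measurable (B n).
  have := mh measurableT _ (measurable_itv `[(- (n%:R * c)), +oo[).
  by rewrite setTI (_ : _ @^-1` _ = B n)//; apply/seteqP; split => x /=; rewrite in_itv /= andbT.
have full (F : nat -> set (measurableTypeR R)) : (forall n, measurable (F n)) ->
    nondecreasing_seq F -> \bigcup_n F n = setT ->
    (forall n, mu (F n.+1 `&` `[0, 1[) = mu (F n `&` `[0, 1[)) ->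
    mu (F 0%N `&` `[0, 1[) = 1%E.
  move=> mF ndF UF Fn.
  have E n : mu (F n `&` `[0, 1[) = mu (F 0%N `&` `[0, 1[) by elim: n => // n <-.
  have : mu (F n `&` `[0, 1[) @[n --> \oo] --> mu (\bigcup_n (F n `&` `[0, 1[)).
    apply: nondecreasing_cvg_mu.
    - by move=> n; exact: measurableI.
    - by apply: bigcup_measurable => n _; exact: measurableI.
    - by move=> m n mn; apply/subsetPset; apply: setSI; exact/subsetPset/ndF.
  rewrite -setI_bigcupl UF setTI lebesgue_measure_itv /= lte_fin ltr01 sube0.
  under eq_fun do rewrite E.
  by move=> /cvg_lim <- //; rewrite lim_cst.
have muA : mu (A 0%N `&` `[0, 1[) = 1%E.
  apply: full => //.
  - move=> m n mn; apply/subsetPset => x /lt_le_trans; apply.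
    by rewrite ler_pM2r// ler_nat.
  - apply/seteqP; split => // x _.
    exists (Num.truncn (h x / c)).+1 => //=.
    by rewrite /A /= -ltr_pdivrMr// truncnS_gt.
  - move=> n; rewrite -(@lebesgue_measure_circle_rotation b (A n))//.
      congr (mu (_ `&` _)); apply/seteqP; split => x; rewrite /A /= hb -natr1; lra.
    by move=> x; rewrite /A /= h1.
have muB : mu (B 0%N `&` `[0, 1[) = 1%E.
  apply: full => //.
  - move=> m n mn; apply/subsetPset => x; apply: le_trans.
    by rewrite lerN2 ler_pM2r// ler_nat.
  - apply/seteqP; split => // x _.
    exists (Num.truncn (- h x / c)).+1 => //=.
    by rewrite /B /= lerNl ltW// -ltr_pdivrMr// truncnS_gt.
  - move=> n; rewrite -(@lebesgue_measure_circle_rotation b (B n.+1))//.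
      congr (mu (_ `&` _)); apply/seteqP; split => x; rewrite /B /= hb -natr1; lra.
    by move=> x; rewrite /B /= h1.
have : mu ((A 0%N `&` `[0, 1[) `|` (B 0%N `&` `[0, 1[)) = (1 + 1)%E.
  rewrite measureU; try exact: measurableI.
    by congr (_ + _)%E; [exact: muA|exact: muB].
  by apply/seteqP; split => x //= [[+ _] [+ _]]; rewrite /A /B /= mul0r oppr0; lra.
rewrite -setIUl (_ : A 0%N `|` B 0%N = setT); last first.
  apply/seteqP; split => // x _; rewrite /A /B /= mul0r oppr0.
  by case: (ltP (h x) 0); [left|right].
rewrite setTI lebesgue_measure_itv /= lte_fin ltr01 sube0 => /eqP.
by rewrite -EFinD eqe; lra.
Qed.
End Drift.

(** * Divisors made of rows of points *)

Section Separated.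
Variable R : realType.

Definition separated (S : set (Cplx R)) :=
  forall z w, S z -> S w -> `|z - w| < 1 -> z = w.

Lemma separated_discrete S : separated S -> discrete_subset S.
Proof.
move=> sS z Sz; exists (ball z 1); first by split; [exact: ball_open|exact: ballxx].
apply/seteqP; split => [w [/= zw Sw]|w ->]; last by split => //; exact: ballxx.
by apply/esym/sS => //; rewrite -ball_normE in zw.
Qed.

Lemma separated_closed S : separated S -> closed S.
Proof.
move=> sS z clz.
have half (u v : Cplx R) : ball z (1 / 2) u -> ball z (1 / 2) v -> `|u - v| < 1.
  move=> zu zv; rewrite (splitr 1); have := ball_triangle (ball_sym zu) zv.
  by rewrite -ball_normE.
have h0 : (0 : Cplx R) < 1 / 2 by rewrite divr_gt0.
have [w [Sw zw]] := clz _ (nbhsx_ballx z _ h0).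
apply: contrapT => nSz.
have wz : 0 < `|z - w| by rewrite normr_gt0 subr_eq0; apply/eqP => zE; rewrite zE in nSz.
have [v [Sv [zv zv']]] := clz _ (filterI (nbhsx_ballx z _ h0) (nbhsx_ballx z _ wz)).
by have := sS _ _ Sw Sv (half _ _ zw zv) => wv; move: zv'; rewrite -wv -ball_normE /ball_ /= ltxx.
Qed.

End Separated.

Section Rows.
Variable R : realType.
Implicit Type p : int -> R.

(** The point set with one row at each integer height [k], of period 1 and
    offset [p k]. *)
Definition rows p : set (Cplx R) :=
  [set cart (p mk.2 + mk.1%:~R, mk.2%:~R) | mk in [set: int * int]].

Lemma int_close (m n : int) : `|m%:~R - n%:~R : R| < 1 -> m = n.
Proof.
move=> mn; apply/eqP; rewrite -subr_eq0 -absz_eq0 -leqn0 -ltnS.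
by rewrite -(ltr_nat R) natr_absz intr_norm rmorphB.
Qed.

Lemma rows_separated p : separated (rows p).
Proof.
move=> _ _ [[m k] _ <-] [[m' k'] _ <-] /= h.
have kk : k = k'.
  apply: int_close; rewrite -ltcR; apply: le_lt_trans h.
  by apply: le_trans (norm_Im _).
rewrite -kk in h *; congr (cart (_ + _%:~R, _)).
apply: int_close; rewrite -ltcR; apply: le_lt_trans h.
apply: le_trans (norm_Re _); rewrite raddfB /=.
by rewrite opprD addrACA subrr add0r.
Qed.

Definition row_count p (z : Cplx R) : nat := `[< rows p z >].

Lemma row_supportE p : div_support (row_count p) = rows p.
Proof.
by apply/seteqP; split => z; rewrite /div_support /row_count /= eqb0 negbK => h; [exact: asboolW|exact: asboolT].
Qed.

Lemma row_closed p : closed (div_support (row_count p)).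
Proof. by rewrite row_supportE; exact: (separated_closed (@rows_separated p)). Qed.

Lemma row_discrete p : discrete_subset (div_support (row_count p)).
Proof. by rewrite row_supportE; exact: (separated_discrete (@rows_separated p)). Qed.

Definition row_div p : posdiv R := PosDiv (@row_closed p) (@row_discrete p).

Lemma row_div_act p q w : (forall z, rows p (z + w) <-> rows q z) ->
  posdiv_act w (row_div p) = row_div q.
Proof.
move=> pq; apply: posdiv_eqP; apply/funext => z /=.
by rewrite /shift_fun /row_count; congr nat_of_bool; apply: asbool_equiv_eq.
Qed.

Lemma row_div_act_inv p q w : posdiv_act w (row_div p) = row_div q ->
  forall z, rows p (z + w) <-> rows q z.
Proof.
move=> /(congr1 (@posdiv_fun R)) pq z.
have := congr1 (fun f => f z) pq; rewrite /= /shift_fun /row_count.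
by case: asboolP => h1; case: asboolP => h2.
Qed.

Lemma rowsE p z : rows p z <-> exists m k : int, Re z = p k + m%:~R /\ Im z = k%:~R.
Proof.
split=> [[[m k] _ <-]|[m [k [zr zi]]]]; first by exists m, k.
by exists (m, k) => //=; rewrite /cart /= -zr -zi; case: z {zr zi}.
Qed.

End Rows.

Lemma even_add2 (k : int) : (2 %| k + 2)%Z = (2 %| k)%Z.
Proof. by rewrite !dvdzE /=; apply/idP/idP; lia. Qed.

Lemma even_add1 (k : int) : (2 %| k + 1)%Z = ~~ (2 %| k)%Z.
Proof. by rewrite !dvdzE /=; apply/idP/idP; lia. Qed.

Section Phase.
Variables (R : realType) (alpha : R).
Hypothesis irr : forall k m : int, k%:~R * alpha = m%:~R -> k = 0.

(** The even rows pin down the horizontal part of a translation preserving the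
    divisor, the odd rows rotate with [theta]. *)
Definition phase (theta : R) (k : int) : R :=
  if (2 %| k)%Z then 0 else theta + k%:~R * alpha.

Definition phase_div theta := row_div (phase theta).

Lemma phase_div_per theta : phase_div (theta + 1) = phase_div theta.
Proof.
rewrite /phase_div -(posdiv_act0 (row_div (phase (theta + 1)))).
apply: row_div_act => z; rewrite addr0 !rowsE /phase.
split=> -[m [k [zr zi]]].
  exists (if (2 %| k)%Z then m else m + 1), k; split=> //; rewrite zr.
  by case: ifP => _ //; rewrite rmorphD /=; ring.
exists (if (2 %| k)%Z then m else m - 1), k; split=> //; rewrite zr.
by case: ifP => _ //; rewrite rmorphB /=; ring.
Qed.

Lemma phase_div_shift1 theta : posdiv_act 1 (phase_div theta) = phase_div theta.
Proof.
apply: row_div_act => z; rewrite !rowsE !raddfD /= addr0.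
split=> -[m [k [zr zi]]].
  by exists (m - 1), k; split => //; rewrite rmorphB /= addrA -zr addrK.
by exists (m + 1), k; split => //; rewrite rmorphD /= addrA -zr.
Qed.

Lemma phase_div_shift2i theta :
  posdiv_act (0 +i* 2)%C (phase_div theta) = phase_div (theta + 2 * alpha).
Proof.
have ph k : phase (theta + 2 * alpha) k = phase theta (k + 2).
  rewrite /phase even_add2; case: ifP => // _; rewrite rmorphD /=; ring.
apply: row_div_act => z; rewrite !rowsE !raddfD /= addr0.
split=> -[m [k [zr zi]]].
  exists m, (k - 2); rewrite ph subrK; split => //.
  by rewrite rmorphB /= -zi addrK.
exists m, (k + 2); rewrite -ph; split => //.
by rewrite rmorphD /= -zi.
Qed.

(** Let [w] be in the stabilizer and let [k] be its height. Translation by [w]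
    maps row [j] onto row [j + k]. For odd [k], comparing [j = 0] and [j = 2]
    makes [2 * alpha] an integer. For even [k], the row [j = 0] gives that
    [Re w] is an integer, and then the row [j = 1] that [k * alpha] is one, so
    that [k] is [0]. *)
Lemma phase_div_stabilizer theta : rank_one (stabilizer (@posdiv_act R) (phase_div theta)).
Proof.
exists 1; first exact: oner_neq0.
apply/seteqP; split => [w /= /row_div_act_inv H|_ [n _ <-]]; last first.
  rewrite /stabilizer /=.
  have N m : posdiv_act (m%:R) (phase_div theta) = phase_div theta.
    elim: m => [|m IH]; first exact: posdiv_act0.
    by rewrite -natr1 -posdiv_actD phase_div_shift1.
  case: n => n; first exact: N.
  by rewrite NegzE -{1}(N n.+1) posdiv_actD mulrNz pmulrn addNr posdiv_act0.
have {}H j : exists m k : int, phase theta j + Re w = phase theta k + m%:~R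
     /\ j%:~R + Im w = k%:~R.
  have /H : rows (phase theta) (cart (phase theta j, j%:~R)).
    by apply/rowsE; exists 0, j; rewrite addr0.
  by move=> /rowsE[m [k []]]; rewrite !raddfD /= => ? ?; exists m, k.
have [m0 [k [w0 k0]]] := H 0.
have kj j k' : j%:~R + Im w = k'%:~R -> k' = k + j.
  move=> e; apply/eqP; rewrite -(eqr_int R) -e rmorphD /= -k0 add0r.
  by rewrite addrC.
have [m1 [k1 [w1 /kj ?]]] := H 1; subst k1.
have [m2 [k2 [w2 /kj ?]]] := H 2; subst k2.
have d0 : (2 %| 0)%Z by [].
have d1' : (2 %| 1)%Z = false by [].
have d2' : (2 %| 2)%Z by [].
have {}k0 : Im w = k%:~R by rewrite -k0 add0r.
move: w0 w1 w2; rewrite /phase even_add2 even_add1 d0 d1' d2' !add0r.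
case: ifP => dk /= w0 w1 w2; last first.
  have /irr : 2%:~R * alpha = (m0 - m2)%:~R.
    by rewrite rmorphB /=; move: w2; rewrite w0 rmorphD /=; lra.
  by [].
rewrite add0r in w0; rewrite w0 in w1.
have /irr kz : k%:~R * alpha = (m0 - m1)%:~R.
  by rewrite rmorphB /=; move: w1; rewrite rmorphD /=; lra.
exists m0 => //; move: w0 k0; rewrite kz; clear; case: w => a b /= -> ->.
by apply/eqP; rewrite eq_complex raddfMz raddfMz /= mul0rz !eqxx.
Qed.

End Phase.

(** * Continuity in the vague topology *)

Section Vague.
Variables (R : realType).

Lemma test_fun_bounded (phi : test_fun R) :
  exists M : R, forall z, phi z != 0 -> `|Re z| <= M /\ `|Im z| <= M.
Proof.
pose K := closure [set z | phi z != 0].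
have bnd (f : Cplx R -> R) : continuous f -> exists M : R, forall z, K z -> `|f z| <= M.
  move=> cf.
  have /compact_bounded [M [_ HM]] : compact (f @` K).
    apply: continuous_compact; last exact: test_fun_supp.
    exact: continuous_subspaceT.
  by exists (M + 1) => z Kz; apply: HM; [rewrite ltrDl|exists z].
have [M1 H1] := bnd _ (@Re_continuous R); have [M2 H2] := bnd _ (@Im_continuous R).
exists (Num.max M1 M2) => z /(@subset_closure _ [set z | phi z != 0]) Kz.
by rewrite !le_max H1// H2// orbT.
Qed.

Definition int_box (N : nat) : set int := [set k | (`|k| <= N)%N].

Lemma finite_int_box N : finite_set (int_box N).
Proof.
apply: (@sub_finite_set _ _ ((fun i : nat => (i : int) - N%:Z) @` `I_(N + N).+1)).
  move=> k; rewrite /int_box /= => kN; exists (absz (k + N%:Z)) => /=; lia.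
by apply: finite_image; exact: finite_II.
Qed.

Variable (alpha : R).

Definition row_point theta (mk : int * int) : Cplx R :=
  cart (phase alpha theta mk.2 + mk.1%:~R, mk.2%:~R).

Lemma row_point_inj theta : injective (row_point theta).
Proof.
move=> [m k] [m' k'] e.
have kk : k = k' by apply/eqP; rewrite -(eqr_int R); apply/eqP; exact: (congr1 (fun z : Cplx R => Im z) e).
rewrite -kk in e *; congr (_, _).
apply/eqP; rewrite -(eqr_int R); apply/eqP; apply: (@addrI _ (phase alpha theta k)).
exact: (congr1 (fun z : Cplx R => Re z) e).
Qed.

Lemma phase_le theta k : `|phase alpha theta k| <= `|theta| + `|k%:~R| * `|alpha|.
Proof.
rewrite /phase; case: ifP => _; first by rewrite normr0 addr_ge0// mulr_ge0.
by rewrite -normrM ler_normD.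
Qed.

Lemma phase_continuous k : continuous (phase alpha ^~ k).
Proof.
move=> x; rewrite /phase; case: (2 %| k)%Z; first exact: cvg_cst.
exact: (cvgD (@cvg_id _ (nbhs x)) (cvg_cst _)).
Qed.

Lemma row_point_continuous mk : continuous (row_point ^~ mk).
Proof.
move=> t.
apply: (@continuous_comp _ _ _ (fun x => (phase alpha x mk.2 + mk.1%:~R, mk.2%:~R : R)) (@cart R));
  last exact: cart_continuous.
have A : phase alpha x mk.2 + mk.1%:~R @[x --> t] --> phase alpha t mk.2 + mk.1%:~R.
  by apply: cvgD; [exact: phase_continuous|exact: cvg_cst].
exact: (cvg_pair A (cvg_cst _)).
Qed.

(** The support of [phi] is bounded, so that for bounded [theta] the same
    finitely many indices account for all the points of the divisor that it
    meets. *)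
Lemma pairing_phase_div (phi : test_fun R) (B : R) : exists N : nat,
  forall theta, `|theta| <= B ->
  pairing phi (phase_div alpha theta) =
  \sum_(mk <- fset_set (int_box N `*` int_box N)) phi (row_point theta mk).
Proof.
have [M HM] := test_fun_bounded phi.
pose N := (Num.truncn (`|M| + `|B| + `|M| * `|alpha|)).+1.
have NE : `|M| + `|B| + `|M| * `|alpha| < N%:R by exact: truncnS_gt.
exists N => theta tB.
rewrite -fsbig_finite; last by apply: finite_setX; exact: finite_int_box.
rewrite /pairing -(@fsbig_widen _ _ _ _ (row_point theta @` (int_box N `*` int_box N)))//; last first.
  (* A point of the divisor where [phi] is nonzero has its indices in the box. *)
  move=> z [_ /= nz]; rewrite /row_count; case: asboolP => [|_]; last by rewrite mulr0n.
  case=> -[m k] _ ze; rewrite mulr1n; apply: contrapT => /eqP /HM.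
  rewrite -ze /= => -[h1 h2]; apply: nz; exists (m, k) => //.
  have Mn : M <= `|M| by exact: ler_norm.
  have Bn : B <= `|B| by exact: ler_norm.
  have an : 0 <= `|alpha| by [].
  have kM : `|k%:~R : R| * `|alpha| <= `|M| * `|alpha|.
    by apply: ler_wpM2r => //; exact: le_trans h2 Mn.
  have ph := phase_le theta k.
  split; rewrite /int_box /= -(ler_nat R) natr_absz intr_norm; last first.
    have : 0 <= `|M| * `|alpha| by rewrite mulr_ge0.
    have : 0 <= `|B| by [].
    lra.
  have mE : m%:~R = (phase alpha theta k + m%:~R) - phase alpha theta k by rewrite addrC addKr.
  rewrite mE; apply: le_trans (ler_normB _ _) _; lra.
rewrite fsbig_image; last by move=> ? ? _ _; exact: row_point_inj.
apply: eq_fsbigr => mk _; rewrite /= /row_count asboolT ?mulr1n//.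
by exists mk.
Qed.

(** Locally in [theta], each pairing is a finite sum of continuous functions. *)
Lemma phase_div_continuous : continuous (phase_div alpha : R -> posdiv R).
Proof.
move=> theta; apply/cvg_sup => phi.
have : continuous (pairing phi \o phase_div alpha).
  move=> t; rewrite /continuous_at /=.
  have [N HN] := pairing_phase_div phi (`|t| + 1).
  rewrite HN ?lerDl//.
  have C : \sum_(mk <- fset_set (int_box N `*` int_box N)) phi (row_point x mk) @[x --> t] -->
      \sum_(mk <- fset_set (int_box N `*` int_box N)) phi (row_point t mk).
    apply: cvg_big; first exact: add_continuous.
    move=> mk _; apply: (@continuous_comp _ _ _ (row_point ^~ mk) phi); last exact: test_fun_cont.
    exact: row_point_continuous.
  apply: cvg_trans C.
  apply: near_eq_cvg; near=> x; rewrite /= HN//.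
  rewrite -lerBlDl; apply: le_trans (lerB_dist _ _) _.
  by rewrite ltW//; near: x; apply: cvgr_distC_lt.
by move=> /continuous_comp_initial; apply.
Unshelve. all: end_near. Qed.

End Vague.

(** * Winding numbers of functions vanishing on rows *)

Section WindingRows.
Variable R : realType.

Definition winding (f : Cplx R -> Cplx R) (y : R) : R :=
  lim (winding_approx f 0 y n @[n --> \oo]).

Lemma near_eq_lim (u : nat -> R) : (\forall n \near \oo, u n.+1 = u n) ->
  \forall n \near \oo, u n = lim (u n @[n --> \oo]).
Proof.
case=> N _ HN.
have E n : u (N + n)%N = u N.
  by elim: n => [|n IH]; rewrite ?addn0// addnS HN//= leq_addr.
have uN : \forall n \near \oo, u N = u n.
  by exists N => // n /= /subnKC <-.
have -> : lim (u n @[n --> \oo]) = u N.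
  by apply/cvg_lim => //; apply: cvg_trans (near_eq_cvg uN) _; exact: cvg_cst.
by apply: filterS uN.
Qed.

Lemma entire_continuous (f : entire R) : continuous f.
Proof.
move=> z; apply: differentiable_continuous; apply/derivable1_diffP.
exact: entire_derivable.
Qed.

Section Rows.
Variables (f : entire R) (p : int -> R).
Hypothesis f1 : forall z, f (z + 1) = f z.
Hypothesis fp : is_div f (row_div p).

Lemma rows_zero z : ~ rows p z -> f z != 0.
Proof.
move=> pz; have [g gz fE] := fp z.
by rewrite fE /= /row_count asboolF// expr0 mul1r.
Qed.

Lemma half_line_nonzero (k : int) x : f (cart (x, k%:~R + 1 / 2)) != 0.
Proof.
apply: rows_zero => /rowsE[m [j [_ /= e]]].
have /intr_inj : (2 * k + 1)%:~R = (2 * j)%:~R :> R.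
  by rewrite rmorphD !rmorphM /= -e; field.
lia.
Qed.

Lemma winding_half_line (k : int) : \forall n \near \oo,
  winding_approx f 0 (k%:~R + 1 / 2) n = winding f (k%:~R + 1 / 2).
Proof.
apply/near_eq_lim/winding_stable; first exact: entire_continuous.
by move=> u _; exact: half_line_nonzero.
Qed.

(** The numbers [0] and [1 / 2] are not both integer translates of [a]. *)
Lemma rows_base (a : R) :
  exists2 x, x = 0 \/ x = 1 / 2 & exists m : int, x < a + m%:~R < x + 1.
Proof.
have := floor_itv a; rewrite intrD1 => /andP[a0 a1].
have [aE|aN] := eqVneq a (Num.floor a)%:~R.
  by exists (1 / 2); [right|exists (1 - Num.floor a); rewrite rmorphB /=; lra].
exists 0; [left|exists (- Num.floor a)] => //.
have : (Num.floor a)%:~R < a by rewrite lt_def a0 aN.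
rewrite rmorphN /=; lra.
Qed.

(** The square of [winding_step] is placed between the two lines, with its
    vertical sides off the row of zeros, so that it contains exactly one zero.
    The equality is read off a polygon fine enough for all the limits
    involved. *)
Lemma winding_drop (k : int) :
  winding f (k%:~R + 1 / 2) = winding f ((k + 1)%:~R + 1 / 2) + 2 * pi.
Proof.
have [x x01 [m xm]] := rows_base (p (k + 1)).
pose z0 := cart (p (k + 1) + m%:~R, (k + 1)%:~R).
have pz0 : rows p z0 by apply/rowsE; exists m, (k + 1).
have [g gz fE] := fp z0.
rewrite /= /row_count asboolT// in fE.
have step : \forall n \near \oo, winding_approx f x (k%:~R + 1 / 2) n =
    winding_approx f x ((k + 1)%:~R + 1 / 2) n + 2 * pi.
  have -> : (k + 1)%:~R + 1 / 2 = k%:~R + 1 / 2 + 1 :> R by rewrite rmorphD /=; ring.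
  apply: (@winding_step R f g z0) => //.
  - exact: entire_continuous.
  - exact: entire_continuous.
  - by rewrite /= rmorphD /=; lra.
  - move=> w xw yw wz; apply: rows_zero => /rowsE[m' [j [wr wi]]].
    have jk : j = k + 1.
      by apply: (@int_close R); rewrite rmorphD /= -wi ltr_norml; lra.
    have mm : m' = m.
      apply: (@int_close R).
      have -> : m'%:~R - m%:~R = Re w - (p (k + 1) + m%:~R) :> R.
        by rewrite wr jk; ring.
      by rewrite ltr_norml; lra.
    move/eqP: wz; apply; case: w {xw yw} wr wi => a b /= -> ->.
    by rewrite jk mm.
have base y n : winding_approx f x y n.+1 = winding_approx f 0 y n.+1.
  by case: x01 => ->//; exact: winding_base.
have [n] : exists n, (0 < n)%N /\ 
    (winding_approx f 0 (k%:~R + 1 / 2) n = winding f (k%:~R + 1 / 2) /\ 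
     winding_approx f 0 ((k + 1)%:~R + 1 / 2) n = winding f ((k + 1)%:~R + 1 / 2)) /\
     winding_approx f x (k%:~R + 1 / 2) n =
    winding_approx f x ((k + 1)%:~R + 1 / 2) n + 2 * pi.
  apply: (@filter_ex _ \oo); near=> n; split; first by near: n; exists 1%N.
  split; last by near: n.
  by split; near: n; exact: winding_half_line.
case: n => [[]//|n] [_ [[<- <-]]].
by rewrite !base.
Unshelve. all: end_near. Qed.

End Rows.
End WindingRows.

(** * Measurability *)

Section Measurability.
Variable R : realType.

Lemma measurable_preimage_borel (T : topologicalType) (g : R -> T) :
  continuous g -> forall B : set T, borel B ->
  measurable (g @^-1` B : set (measurableTypeR R)).
Proof.
move=> cg; apply: smallest_sub.
  split.
  - by rewrite /= preimage_set0; exact: measurable0.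
  - move=> A mA; rewrite setTD /= preimage_setC; exact: measurableC.
  - move=> F mF /=; rewrite preimage_bigcup; exact: bigcup_measurable.
by move=> V oV /=; apply: open_measurable; move/continuousP: cg; apply.
Qed.

Lemma entire_eval_continuous z : continuous (fun f : entire R => f z).
Proof.
have c0 : continuous (fun f : entire R => (f : {family compact, Cplx R -> Cplx R})).
  exact: initial_continuous.
move=> f; have H := pointwise_cvg_compact_family _ (c0 f) _.
by apply: (pointwise_cvgP _ _).1 (H _) z; exact: (@fmap_filter _ _ _ _ (nbhs_filter f)).
Qed.

Lemma measurable_ang (u v : R -> Cplx R) :
  measurable_fun [set: measurableTypeR R] (fun x => Re (u x)) ->
  measurable_fun [set: measurableTypeR R] (fun x => Im (u x)) ->
  measurable_fun [set: measurableTypeR R] (fun x => Re (v x)) ->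
  measurable_fun [set: measurableTypeR R] (fun x => Im (v x)) ->
  measurable_fun [set: measurableTypeR R] (fun x => ang (u x) (v x)).
Proof.
move=> ur ui vr vi.
have md : measurable_fun [set: measurableTypeR R] (fun x => dot (u x) (v x)).
  by apply: measurable_funD; apply: measurable_funM.
have mc : measurable_fun [set: measurableTypeR R] (fun x => cross (u x) (v x)).
  by apply: measurable_funB; apply: measurable_funM.
have matan : measurable_fun [set: R] (@atan R).
  apply: continuous_measurable_fun => x; exact: continuous_atan.
(* The inverse is continuous away from [0]. *)
have minv : measurable_fun [set: R] (@GRing.inv R).
  have -> : [set: R] = [set x | x != 0] `|` [set 0].
    by apply/seteqP; split => // x _; have [->|] := eqVneq x 0; [right|left].
  have on0 : open [set x : R | x != 0].
    have -> : [set x : R | x != 0] = ~` [set 0] by apply/seteqP; split => x /eqP.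
    by apply: closed_openC; exact: closed_eq.
  apply/measurable_funU => //; first exact: open_measurable.
  split; last exact: measurable_fun_set1.
  apply: open_continuous_measurable_fun => //.
  by move=> x; rewrite inE => x0; exact: inv_continuous.
apply: (measurableT_comp matan); apply: measurable_funM => //.
exact: (measurableT_comp minv).
Qed.

Variable F : R -> entire R.
Hypothesis mF : forall V : set (entire R), open V ->
  measurable (F @^-1` V : set (measurableTypeR R)).

Lemma measurable_entire_eval (h : Cplx R -> R) z : continuous h ->
  measurable_fun [set: measurableTypeR R] (fun x => h (F x z)).
Proof.
move=> ch; apply: (measurability _ (RGenOpens.measurableE R)) => //.
move=> _ [_ [a [b ->]] <-]; rewrite setTI.
apply: (mF (V := (fun f : entire R => h (f z)) @^-1` `]a, b[%classic)).
suff /continuousP : continuous (fun f : entire R => h (f z)) by apply; exact: interval_open.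
by move=> f; apply: continuous_comp; [exact: entire_eval_continuous|exact: ch].
Qed.

Lemma measurable_winding_approx y n :
  measurable_fun [set: measurableTypeR R] (fun x => winding_approx (F x) 0 y n).
Proof.
apply: measurable_sum => j; apply: measurable_ang; apply: measurable_entire_eval;
  by [exact: Re_continuous|exact: Im_continuous].
Qed.

End Measurability.

(** * Absence of an equivariant Borel right inverse of the divisor map *)

(** Otherwise [k ^ 2 = 8 * m ^ 2], where the exponents of 2 have different
    parities. *)
Lemma sqrt2_quarter_irrational (R : realType) (k m : int) :
  k%:~R * (Num.sqrt 2 / 4) = m%:~R :> R -> k = 0.
Proof.
move=> km.
have E : k ^+ 2 = 8 * m ^+ 2.
  apply/eqP; rewrite -(eqr_int R) rmorphXn /= [X in _ == X]rmorphM /= [X in _ == _ * X]rmorphXn /= -km.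
  apply/eqP; rewrite exprMn expr_div_n sqr_sqrtr//.
  by field.
have [->//|k0] := eqVneq k 0.
have m0 : m != 0.
  by apply: contra_neq k0 => m0; apply/eqP; rewrite -sqrf_eq0 E m0 expr0n mulr0.
have : (`|k| ^ 2 = 2 ^ 3 * `|m| ^ 2)%N.
  by have := congr1 absz E; rewrite abszM !abszX.
move/(congr1 (logn 2)); rewrite lognM ?expn_gt0 ?absz_gt0 ?m0//.
by rewrite !lognX (logn_prime 2 (isT : prime 2)) /=; lia.
Qed.

Theorem theorem7p1 (R : realType) :
  ~ exists xi : posdiv1 R -> entire1 R,
      [/\ borel_map xi,
          forall (w : Cplx R) (d : posdiv1 R),
            xi (posdiv1_act w d) = entire1_act w (xi d)
        & forall d : posdiv1 R, is_div (set_val (xi d)) (set_val d)].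
Proof.
move=> [xi [bxi exi dxi]].
(* Any irrational number works; with this one [2 * alpha] lies in [0, 1]. *)
pose alpha : R := Num.sqrt 2 / 4.
have irr (k m : int) : k%:~R * alpha = m%:~R -> k = 0 by exact: sqrt2_quarter_irrational.
have rk theta : phase_div alpha theta \in posdiv1 R.
  by apply/mem_set; exact: phase_div_stabilizer.
pose D theta : posdiv1 R := SigSub (rk theta).
pose F theta : entire R := set_val (xi (D theta)).
have cD : continuous D.
  by apply: continuous_comp_initial; exact: phase_div_continuous.
have DE w theta theta' : posdiv_act w (phase_div alpha theta) = phase_div alpha theta' ->
    forall z, F theta (z + w) = F theta' z.
  move=> e z; rewrite /F; have <- : posdiv1_act w (D theta) = D theta' by apply: val_inj.
  by rewrite exi.
have F1 theta z : F theta (z + 1) = F theta z by apply: DE; exact: phase_div_shift1.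
have Fp theta : is_div (F theta) (row_div (phase alpha theta)) := dxi (D theta).
pose h theta := winding (F theta) (1 / 2).
have hE (k : int) theta : \forall n \near \oo,
    winding_approx (F theta) 0 (k%:~R + 1 / 2) n = winding (F theta) (k%:~R + 1 / 2).
  exact: winding_half_line (Fp theta) k.
apply: (@no_drift R h (2 * alpha) (4 * pi)).
- apply: (measurable_fun_cvg (h := fun n theta => winding_approx (F theta) 0 (1 / 2) n)).
    move=> n; apply: measurable_winding_approx => V oV.
    have := measurable_preimage_borel cD (B := xi @^-1` (set_val @^-1` V)).
    apply; apply: bxi; apply: sub_gen_smallest.
    have /continuousP := @initial_continuous (entire1 R) (entire R) set_val.
    by apply.
  move=> theta _; apply: cvg_trans (near_eq_cvg _) (cvg_cst (h theta)).
  have := hE 0 theta; rewrite add0r; apply: filterS => n.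
  by move=> /esym.
- by move=> theta; rewrite /h /F /D; congr (winding (set_val (xi _)) _); apply: val_inj;
    exact: phase_div_per.
- have s0 : 0 <= Num.sqrt 2 :> R by [].
  have s2 : Num.sqrt 2 <= 2 :> R.
    by rewrite -[leRHS]ger0_norm// -sqrtr_sqr ler_wsqrtr// expr2; lra.
  by rewrite /alpha; apply/andP; split; lra.
- by rewrite mulr_gt0 ?pi_gt0.
- move=> theta.
  have := winding_drop (F1 theta) (Fp theta) 0.
  have := winding_drop (F1 theta) (Fp theta) 1.
  rewrite !add0r -/(h theta).
  have -> : winding (F theta) ((1 + 1)%:~R + 1 / 2) = h (theta + 2 * alpha).
    rewrite /h /winding; suff -> : winding_approx (F theta) 0 ((1 + 1)%:~R + 1 / 2) =
      winding_approx (F (theta + 2 * alpha)) 0 (1 / 2) by [].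
    apply/funext => n; congr turn; apply/funext => j.
    rewrite -(DE _ _ _ (phase_div_shift2i alpha theta)); congr (entire_fun (F theta) _).
    by apply/eqP; rewrite eq_complex /= addr0 eqxx /= addrC.
  by lra.
Qed.
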